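(* Let $T\in\mathbb{N}$, let $(\Omega,\mathcal{F},\mathbb{P})$ be a probability space with filtration $\mathcal{F}_0\subset\cdots\subset\mathcal{F}_T=\mathcal{F}$, let $\mathbb{A}$ be a finite set of agents with cardinality $|\mathbb{A}|$, and for each $a\in\mathbb{A}$ let $(H^a_t)_{t=0}^T$ be a process with $H^a_t\in L^0_{t,++}$. Put $H_t=\sum_{a\in\mathbb{A}}H^a_t$ for $t=0,\dots,T$. For $t=0,\dots,T-1$ let $g_t:\underline{L}^0_{t+1}\to\underline{L}^0_t$ be $\mathcal{F}_t$-concave, increasing and sequentially upper semi-continuous with $g_t(0)=0$, and define $$u_t(x,y):=x\,g_t(y/x),\qquad x\in L^0_{t,++},\ y\in\underline{L}^0_{t+1}.$$ Let $u_T$ be the identity on $L^0_{T,++}$. For $t=0,\dots,T$ consider the wealth-dependent dynamic risk sharing problem $$y_t\big((H^a_t)_{a\in\mathbb{A}}\big)=\sup\Big\{\sum_{a\in\mathbb{A}}u_t(H^a_t,\cdot)\circ u_{t+1}(x^a_{t+1},\cdot)\circ\cdots\circ u_{T-1}(x^a_{T-1},x^a_T):\ \sum_{a\in\mathbb{A}}x^a_s=H_s,\ x^a_s\in L^0_{s,++},\ s=t+1,\dots,T\Big\}$$ (for $t=T$ this is $y_T((H^a_T)_{a\in\mathbb{A}})=\sum_{a\in\mathbb{A}}H^a_T$). Then this problem has the optimal solution $$x^{a,*}_s=\frac{H^a_t}{H_t}H_s,\qquad a\in\mathbb{A},\ s=t+1,\dots,T.$$ Moreover, for $t=0,\dots,T$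 the function $y_t:L^0_t\big((0,\infty)^{|\mathbb{A}|}\big)\to\underline{L}^0_t$ is $\mathcal{F}_t$-stable, increasing and sequentially upper semi-continuous.
   Context: Functions on $\Omega$ are identified if they coincide a.s., and inequalities between random variables hold a.s. $L^0_t$, $L^0_{t,++}$, $\underline{L}^0_t$ and $L^0_t((0,\infty)^{|\mathbb{A}|})$ denote the spaces of $\mathcal{F}_t$-measurable random variables with values in $\mathbb{R}$, $(0,\infty)$, $\mathbb{R}\cup\{-\infty\}$ and $(0,\infty)^{|\mathbb{A}|}$. Suprema are essential suprema. A function $f$ is $\mathcal{F}_t$-stable if $f(\sum_k1_{A_k}x_k)=\sum_k1_{A_k}f(x_k)$ for every countable partition $(A_k)$ of $\Omega$ with $A_k\in\mathcal{F}_t$ and every sequence $(x_k)$, where $\sum_k1_{A_k}x_k$ equals $x_k$ on $A_k$. It is sequentially upper semi-continuous if $x_k\to x$ a.s. implies $\limsup_kf(x_k)\le f(x)$ a.s. It is increasing if it is monotone with respect to the a.s. (componentwise) order. $g_t$ is $\mathcal{F}_t$-concave if $g_t(\lambda y+(1-\lambda)y')\ge\lambda g_t(y)+(1-\lambda)g_t(y')$ for all $y,y'\in\underline{L}^0_{t+1}$ and $\lambda\in L^0_t$ with $0\le\lambda\le1$, with the convention $0\cdot(-\infty)=0$. In the compositions, $u_s(x^a_s,\cdot)$ is regarded as a map $\underline{L}^0_{s+1}\to\underline{L}^0_s$, so the expression is $u_t(H^a_t,u_{t+1}(x^a_{t+1},\dots u_{T-1}(x^a_{T-1},x^a_T)\dots))$.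 As a function on $L^0_t((0,\infty)^{|\mathbb{A}|})$, $y_t$ is the value of the problem in which the time-$t$ endowments $(H^a_t)_{a\in\mathbb{A}}$ are replaced by an arbitrary vector $(x^a)_{a\in\mathbb{A}}\in L^0_t((0,\infty)^{|\mathbb{A}|})$ while the aggregate endowments $H_s$, $s=t+1,\dots,T$, are kept fixed. *)

(* Defs.v *)
From mathcomp Require Import all_boot all_order all_algebra.
From mathcomp Require Import all_classical all_reals all_analysis.
From mathcomp Require Import measurable_realfun.

Set Implicit Arguments.
Unset Strict Implicit.
Unset Printing Implicit Defensive.

Import Order.TTheory GRing.Theory Num.Theory.
Import numFieldNormedType.Exports.

Local Open Scope classical_set_scope.
Local Open Scope ring_scope.

(* Elements of the L^0 spaces are represented by functions on Omega, not by
   classes: equalities and inequalities of random variables, including the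
   constraints "positive" and "less than +oo", hold P-almost surely, and maps on
   L^0 spaces are required to be compatible with almost sure equality. *)

Section RandomVariables.
Context {d : measure_display} {Omega : measurableType d} {R : realType}.
Variable P : probability Omega R.

Definition filtration (T : nat) (F : nat -> set (set Omega)) : Prop :=
  [/\ forall t, (t <= T)%N -> sigma_algebra setT (F t),
      forall s t, (s <= t)%N -> (t <= T)%N -> F s `<=` F t
    & F T = measurable].

(* [g_sigma_algebraType G] is Omega with the sigma-algebra generated by G,
   which is G itself when G is a sigma-algebra. *)
Definition measurable_wrt (G : set (set Omega)) {d' : measure_display}
    {V : measurableType d'} (f : Omega -> V) : Prop :=
  measurable_fun setT (f : g_sigma_algebraType G -> V).

Definition ae_le {disp : Order.disp_t} {V : porderType disp}
    (f f' : Omega -> V) : Prop :=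
  \forall w \ae P, (f w <= f' w)%O.

Definition ae_cvg {V : topologicalType} (f : nat -> Omega -> V)
    (l : Omega -> V) : Prop :=
  \forall w \ae P, f ^~ w @ \oo --> l w.

(* L^0(G) *)
Definition L0 (G : set (set Omega)) : set (Omega -> R) :=
  [set f : Omega -> R | measurable_wrt G f].

(* L^0_{++}(G), values in ]0, +oo[ *)
Definition L0pp (G : set (set Omega)) : set (Omega -> R) :=
  [set f : Omega -> R | measurable_wrt G f /\ \forall w \ae P, 0 < f w].

(* L^0(G) with values in R \cup {-oo} *)
Definition L0bar (G : set (set Omega)) : set (Omega -> \bar R) :=
  [set f : Omega -> \bar R |
    measurable_wrt G f /\ \forall w \ae P, (f w < +oo)%E].

(* L^0(G; ]0, +oo[^I) *)
Definition L0ppv {I : Type} (G : set (set Omega)) : set (I -> Omega -> R) :=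
  [set f | forall i, L0pp G (f i)].

(* The following three properties are stated for a map f on a space D of random
   variables (or random vectors) with its almost sure equality eqD, order leD
   and convergence cvgD. *)

Definition maps_to_L0bar {X : Type} (D : set X) (eqD : X -> X -> Prop)
    (G : set (set Omega)) (f : X -> Omega -> \bar R) : Prop :=
  (forall x, D x -> L0bar G (f x)) /\
  (forall x x', D x -> D x' -> eqD x x' -> f x = f x' %[ae P]).

Definition increasing_on {X : Type} (D : set X) (leD : X -> X -> Prop)
    (f : X -> Omega -> \bar R) : Prop :=
  forall x x', D x -> D x' -> leD x x' -> ae_le (f x) (f x').

Definition seq_usc_on {X : Type} (D : set X) (cvgD : (nat -> X) -> X -> Prop)
    (f : X -> Omega -> \bar R) : Prop :=
  forall (x : nat -> X) (l : X), (forall k, D (x k)) -> D l -> cvgD x l ->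
  ae_le (fun w => limn_esup (fun k => f (x k) w)) (f l).

Definition ae_eqv {I : Type} (f f' : I -> Omega -> R) : Prop :=
  forall i, f i = f' i %[ae P].

Definition ae_lev {I : Type} (f f' : I -> Omega -> R) : Prop :=
  forall i, ae_le (f i) (f' i).

Definition ae_cvgv {I : Type} (f : nat -> I -> Omega -> R)
    (l : I -> Omega -> R) : Prop :=
  forall i, ae_cvg (fun k => f k i) (l i).

Definition concave_wrt (G G' : set (set Omega))
    (f : (Omega -> \bar R) -> Omega -> \bar R) : Prop :=
  forall (y y' : Omega -> \bar R) (l : Omega -> R),
  L0bar G' y -> L0bar G' y' -> L0 G l -> ae_le (cst 0) l -> ae_le l (cst 1) ->
  ae_le (fun w => (l w)%:E * f y w + (1 - l w)%:E * f y' w)%E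
        (f (fun w => (l w)%:E * y w + (1 - l w)%:E * y' w)%E).

Definition countable_partition (G : set (set Omega)) (E : nat -> set Omega) :
    Prop :=
  [/\ forall k, G (E k), trivIset setT E & \bigcup_k E k = setT].

(* \sum_k 1_{E_k} f_k, for a partition E *)
Definition paste {V : Type} (E : nat -> set Omega) (f : nat -> Omega -> V) :
    Omega -> V :=
  fun w => f (xget 0%N [set k | E k w]) w.

Definition stable_on {I : Type} (G : set (set Omega))
    (D : set (I -> Omega -> R)) (f : (I -> Omega -> R) -> Omega -> \bar R) :
    Prop :=
  forall (E : nat -> set Omega) (x : nat -> I -> Omega -> R),
  countable_partition G E -> (forall k, D (x k)) ->
  f (fun i => paste E (fun k => x k i)) = paste E (fun k => f (x k)) %[ae P].

(* Y is a G-measurable version of the essential supremum of S. *)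
Definition is_esssup (G : set (set Omega)) (S : set (Omega -> \bar R))
    (Y : Omega -> \bar R) : Prop :=
  [/\ measurable_wrt G Y,
      forall X, S X -> ae_le X Y
    & forall Z : Omega -> \bar R, measurable_fun setT Z ->
        (forall X, S X -> ae_le X Z) -> ae_le Y Z].

Definition esssup (G : set (set Omega)) (S : set (Omega -> \bar R)) :
    Omega -> \bar R :=
  xget (cst -oo%E) [set Y | is_esssup G S Y].

End RandomVariables.

Section RiskSharing.
Context {d : measure_display} {Omega : measurableType d} {R : realType}.
Variable P : probability Omega R.

(* u(x, y) = x g(y / x) *)
Definition wealth_utility (g : (Omega -> \bar R) -> Omega -> \bar R)
    (x : Omega -> R) (y : Omega -> \bar R) : Omega -> \bar R :=
  fun w => ((x w)%:E * g (fun w' => ((x w')^-1)%:E * y w') w)%E.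

(* With n = T - t: u_t(h, u_{t+1}(x_{t+1}, ... u_{T-1}(x_{T-1}, x_T))). *)
Fixpoint composed_utility (g : nat -> (Omega -> \bar R) -> Omega -> \bar R)
    (n t : nat) (h : Omega -> R) (x : nat -> Omega -> R) : Omega -> \bar R :=
  match n with
  | 0 => fun w => (h w)%:E
  | m.+1 => wealth_utility (g t) h (composed_utility g m t.+1 (x t.+1) x)
  end.

Section Problem.
Context {A : finType}.
Variables (T : nat) (F : nat -> set (set Omega)).
Variables (g : nat -> (Omega -> \bar R) -> Omega -> \bar R).
Variable Hagg : nat -> Omega -> R.

Definition feasible (t : nat) (x : A -> nat -> Omega -> R) : Prop :=
  forall s, (t < s)%N -> (s <= T)%N ->
  (forall a, L0pp P (F s) (x a s)) /\
  (fun w => \sum_(a : A) x a s w) = Hagg s %[ae P].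

Definition objective (t : nat) (h : A -> Omega -> R)
    (x : A -> nat -> Omega -> R) : Omega -> \bar R :=
  fun w => (\sum_(a : A) composed_utility g (T - t) t (h a) (x a) w)%E.

Definition attainable (t : nat) (h : A -> Omega -> R) :
    set (Omega -> \bar R) :=
  [set objective t h x | x in feasible t].

(* y_t, as a function of the time-t endowments h *)
Definition value (t : nat) (h : A -> Omega -> R) : Omega -> \bar R :=
  esssup P (F t) (attainable t h).

Definition optimal (t : nat) (h : A -> Omega -> R)
    (x : A -> nat -> Omega -> R) : Prop :=
  [/\ feasible t x,
      forall x', feasible t x' -> ae_le P (objective t h x') (objective t h x)
    & value t h = objective t h x %[ae P]].

End Problem.
End RiskSharing.

(* Main.v *)
(* The perspective u(x, y) = x g(y / x) of a concave map g is positively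
   homogeneous and superadditive, jointly in x and y, and both properties pass to
   the composition U_t(h, x) of u_t, ..., u_{T-1}. Superadditivity gives
   \sum_a U_t(h_a, x_a) <= U_t(\sum_a h_a, H) for every feasible x, and by
   homogeneity the proportional allocation attains this bound, since its shares
   h_a / \sum_b h_b add up to 1. Hence y_t(h) = U_t(\sum_a h_a, H), which depends
   on h only through x = \sum_a h_a in x g_t(Y / x) with Y fixed; monotonicity and
   stability in x then follow from concavity and g_t(0) = 0, and upper
   semi-continuity from that of g_t. *)

Require Import Defs.
From mathcomp Require Import all_boot all_order all_algebra.
From mathcomp Require Import all_classical all_reals all_analysis.
From mathcomp Require Import measurable_realfun.
From mathcomp Require Import zify ring lra.

Set Implicit Arguments.
Unset Strict Implicit.
Unset Printing Implicit Defensive.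

Import Order.TTheory GRing.Theory Num.Theory.
Import numFieldNormedType.Exports.

Local Open Scope classical_set_scope.
Local Open Scope ring_scope.

(** * Limits superior and inequalities in the extended reals *)

Section ExtendedReals.
Context {R : realType}.
Implicit Types (u v : nat -> \bar R) (x y : \bar R).

Lemma limn_esup_lt_near u x :
  (limn_esup u < x)%E -> \forall n \near \oo, (u n < x)%E.
Proof.
rewrite /limn_esup limf_esupE => /ereal_inf_lt[_ [V nV <-]] supV.
apply: filterS nV => n Vn; apply: le_lt_trans supV.
by apply: ereal_sup_ubound; exists n.
Qed.

Lemma limn_esup_le_near u x :
  (\forall n \near \oo, (u n <= x)%E) -> (limn_esup u <= x)%E.
Proof.
move=> ux; rewrite /limn_esup limf_esupE.
apply: le_trans (_ : (ereal_sup (u @` [set n | (u n <= x)%E]) <= x)%E).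
  by apply: ereal_inf_lbound; exists [set n | (u n <= x)%E].
by apply: ge_ereal_sup => _ [n un <-].
Qed.

(** Testing against real bounds only keeps infinite values out of the estimates: [y = +oo] is
    trivial, and for [y = -oo] suitable real bounds leave only [x = -oo]. *)
Lemma lee_gt_fin x y : (forall r : R, (y < r%:E)%E -> (x <= r%:E)%E) ->
  (x <= y)%E.
Proof.
move=> xy; case: y xy => [y| |] xy; rewrite ?leey//.
  apply/lee_addgt0Pr => e e0; rewrite -EFinD; apply: xy.
  by rewrite lte_fin ltrDl.
case: x xy => [x| |] xy //.
- by have := xy (x - 1) (ltNyr _); rewrite lee_fin => ?; exfalso; lra.
- by have := xy 0 (ltNyr _).
Qed.

Lemma lte_dense_fin x (r : R) : (x < r%:E)%E ->
  exists2 q : R, (x < q%:E)%E & q < r.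
Proof.
case: x => [x| |] //; last by exists (r - 1); rewrite ?ltNyr//; lra.
by rewrite lte_fin => xr; exists ((x + r) / 2); rewrite ?lte_fin; lra.
Qed.

(** No sign or finiteness is asked of [u]. For a real c above l x, some real q lies strictly between
    x and c / l; eventually u n < q, a n > 0 and a n q < c, so a n u n stays below c. *)
Lemma limn_esupM (a : nat -> R) (l : R) u x : a @ \oo --> l -> 0 < l ->
  (limn_esup u <= x)%E ->
  (limn_esup (fun n => (a n)%:E * u n) <= l%:E * x)%E.
Proof.
move=> al l0 ux; apply: lee_gt_fin => c.
rewrite -lte_pdivlMl// -EFinM => /lte_dense_fin[q xq qc].
have a0 : \forall n \near \oo, 0 < a n by exact: cvgr_gt al _ l0.
have aq : \forall n \near \oo, a n * q < c.
  apply: (cvgr_lt (l * q)); first by apply: cvgMl.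
  by rewrite -ltr_pdivlMl.
apply: limn_esup_le_near; near=> n.
apply: (@le_trans _ _ (a n * q)%:E).
  rewrite EFinM lee_pmul2l ?lte_fin//; last by near: n.
  apply/ltW; near: n; apply: limn_esup_lt_near; exact: le_lt_trans xq.
by rewrite lee_fin ltW//; near: n.
Unshelve. all: by end_near. Qed.

(** Distributivity can only fail for a sum of opposite infinities, which is excluded when both terms
    are below +oo. *)
Lemma muleDr_lty (r : R) x y : (x < +oo)%E -> (y < +oo)%E ->
  (r%:E * (x + y) = r%:E * x + r%:E * y)%E.
Proof. by move=> xoo yoo; rewrite muleDr// ltpinfty_adde_def. Qed.

End ExtendedReals.

(** * Almost sure relations, spaces of random variables, pasting and essential suprema *)

Section RandomVariableSpaces.
Context {d : measure_display} {Omega : measurableType d} {R : realType}.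
Variable P : probability Omega R.
Implicit Types (G : set (set Omega)) (x l : Omega -> R) (y : Omega -> \bar R).

(** The notation [%[ae P]] hides a domain premise [setT w]; this lemma removes it and [ae_eqP]
    restores it. *)
Lemma ae_of_ae_eq (V : Type) (f f' : Omega -> V) :
  f = f' %[ae P] -> \forall w \ae P, f w = f' w.
Proof. by apply: filterS => w; apply. Qed.

Lemma ae_eqP (V : Type) (f f' : Omega -> V) :
  (\forall w \ae P, f w = f' w) -> f = f' %[ae P].
Proof. by apply: filterS. Qed.

Lemma ae_and (Q Q' : Omega -> Prop) : (\forall w \ae P, Q w) ->
  (\forall w \ae P, Q' w) -> \forall w \ae P, Q w /\ Q' w.
Proof. exact: filterI. Qed.

Lemma ae_eq_le y y' : y = y' %[ae P] -> ae_le P y y'.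
Proof. by move/ae_of_ae_eq; apply: filterS => w ->. Qed.

Lemma ae_le_trans y y' y'' : ae_le P y y' -> ae_le P y' y'' -> ae_le P y y''.
Proof. by apply: filterS2 => w; exact: le_trans. Qed.

Lemma ae_le_anti y y' : ae_le P y y' -> ae_le P y' y -> y = y' %[ae P].
Proof.
move=> h h'; apply: ae_eqP.
by apply: filterS2 h h' => w a b; apply/le_anti/andP.
Qed.

Lemma measurable_wrt_sub G G' d' (V : measurableType d') (f : Omega -> V) :
  G `<=` G' -> measurable_wrt G f -> measurable_wrt G' f.
Proof.
by move=> GG' mf mD Y mY; apply: (sub_sigma_algebra2 GG'); exact: mf.
Qed.

Lemma measurable_wrt_measurable d' (V : measurableType d') (f : Omega -> V) :
  measurable_wrt measurable f -> measurable_fun setT f.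
Proof.
move=> mf mD Y mY.
rewrite -(sigma_algebra_id (@sigma_algebra_measurable _ Omega)).
exact: mf.
Qed.

(** The inverse is written as x (x^2)^(-1): squaring makes the base of the real power nonnegative,
    so x may have any sign, and at 0 both sides are 0. *)
Lemma measurable_wrtV G x : measurable_wrt G x ->
  measurable_wrt G (fun w => (x w)^-1).
Proof.
move=> mx; rewrite (_ : (fun w => _) = x \* (fun w => powR (x w ^+ 2) (-1))).
  apply: measurable_funM => //.
  apply: (measurableT_comp (@measurable_powR R (-1))).
  exact: measurable_funX.
apply/funext => w /=; rewrite powR_inv1 ?sqr_ge0//.
have [->|xw] := eqVneq (x w) 0; first by rewrite invr0 mul0r.
by rewrite expr2 invfM mulrA divff// mul1r.
Qed.

Lemma L0pp_sub G G' x : G `<=` G' -> L0pp P G x -> L0pp P G' x.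
Proof. by move=> GG' [mx x0]; split => //; exact: measurable_wrt_sub mx. Qed.

Lemma L0ppV G x : L0pp P G x -> L0pp P G (fun w => (x w)^-1).
Proof.
move=> [mx x0]; split; first exact: measurable_wrtV.
by apply: filterS x0 => w; rewrite invr_gt0.
Qed.

Lemma L0ppM G x x' : L0pp P G x -> L0pp P G x' ->
  L0pp P G (fun w => x w * x' w).
Proof.
move=> [mx x0] [mx' x'0]; split; first exact: measurable_funM.
by apply: filterS2 x0 x'0 => w; exact: mulr_gt0.
Qed.

Lemma L0ppD G x x' : L0pp P G x -> L0pp P G x' ->
  L0pp P G (fun w => x w + x' w).
Proof.
move=> [mx x0] [mx' x'0]; split; first exact: measurable_funD.
by apply: filterS2 x0 x'0 => w; exact: addr_gt0.
Qed.

Lemma L0bar_fin G x : L0pp P G x -> L0bar P G (fun w => (x w)%:E).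
Proof.
move=> [mx x0]; split; last by apply: aeW => w; rewrite ltry.
exact/measurable_EFinP.
Qed.

Lemma L0barZ G x y : L0pp P G x -> L0bar P G y ->
  L0bar P G (fun w => (x w)%:E * y w)%E.
Proof.
move=> [mx x0] [my yoo]; split.
  by apply: emeasurable_funM => //; exact/measurable_EFinP.
apply: filterS2 x0 yoo => w x0 yoo; apply: lte_mul_pinfty => //.
by rewrite lee_fin ltW.
Qed.

Lemma L0barD G y y' : L0bar P G y -> L0bar P G y' ->
  L0bar P G (fun w => y w + y' w)%E.
Proof.
move=> [my yoo] [my' y'oo]; split; first exact: emeasurable_funD.
by apply: filterS2 yoo y'oo => w; exact: lte_add_pinfty.
Qed.

(** The empty sum is 0, hence not positive: the induction starts from one summand, here and in
    [composed_utility_sum]. *)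
Lemma L0pp_sum (I : Type) (r : seq I) G (h : I -> Omega -> R) :
  (0 < size r)%N -> L0ppv P G h -> L0pp P G (fun w => \sum_(i <- r) h i w).
Proof.
elim: r => // i [|j r] IH _ hG.
  by rewrite (_ : (fun w => _) = h i)//; apply/funext => w; rewrite big_seq1.
rewrite (_ : (fun w => _) = fun w => h i w + \sum_(k <- j :: r) h k w).
  by apply: L0ppD => //; exact: IH.
by apply/funext => w; rewrite big_cons.
Qed.

Lemma pasteE (V : Type) G (E : nat -> set Omega) (f : nat -> Omega -> V) k w :
  countable_partition G E -> E k w -> paste E f w = f k w.
Proof.
move=> [_ tE _] Ekw; rewrite /paste (_ : xget _ _ = k)//.
by apply: xget_unique => // j Ejw; apply: tE => //; exists w.
Qed.

Lemma countable_partition_cover G (E : nat -> set Omega) w :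
  countable_partition G E -> exists k, E k w.
Proof.
move=> [_ _ cE]; have : setT w by [].
by rewrite -cE => -[k _ Ekw]; exists k.
Qed.

Lemma paste_L0pp G (E : nat -> set Omega) (f : nat -> Omega -> R) :
  countable_partition G E -> (forall k, L0pp P G (f k)) ->
  L0pp P G (paste E f).
Proof.
move=> pE fG; split; last first.
  have : \forall w \ae P, forall k, 0 < f k w.
    by apply: ae_foralln => k; exact: (fG k).2.
  apply: filterS => w f0; have [k Ekw] := countable_partition_cover w pE.
  by rewrite (pasteE _ pE Ekw).
move=> _ Y mY; rewrite setTI.
(* On each cell the pasted map is one of the [f k], so a preimage is a countable union of measurable
   pieces. *)
have -> : paste E f @^-1` Y = \bigcup_k (E k `&` f k @^-1` Y).
  apply/seteqP; split => w /=.
    have [k Ekw] := countable_partition_cover w pE.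
    by rewrite (pasteE _ pE Ekw) => Yw; exists k.
  by move=> [k _ [Ekw Yw]]; rewrite (pasteE _ pE Ekw).
apply: bigcupT_measurable => k; apply: measurableI.
  by have [GE _ _] := pE; exact: sub_sigma_algebra.
by rewrite -[_ @^-1` _]setTI; exact: (fG k).1.
Qed.

(** A maximum belongs to the family, so every upper bound of the family dominates it. *)
Lemma is_esssup_max G (S : set (Omega -> \bar R)) y :
  S y -> measurable_wrt G y -> (forall y', S y' -> ae_le P y' y) ->
  is_esssup P G S y.
Proof. by move=> Sy my yS; split => // z _; apply. Qed.

Lemma is_esssup_ae_eq G (S : set (Omega -> \bar R)) y y' :
  G `<=` measurable -> is_esssup P G S y -> is_esssup P G S y' ->
  y = y' %[ae P].
Proof.
have mG z : measurable_wrt G z -> G `<=` measurable -> measurable_fun setT z.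
  by move=> mz GF; apply: measurable_wrt_measurable; apply: measurable_wrt_sub mz.
move=> GF [my Sy y_min] [my' Sy' y'_min].
by apply: ae_le_anti; [apply: y_min|apply: y'_min] => //; exact: mG.
Qed.

(** [esssup] is a choice, so exhibiting one essential supremum makes the chosen one genuine. Below,
    the witness is an attained maximum. *)
Lemma esssupP G (S : set (Omega -> \bar R)) y :
  is_esssup P G S y -> is_esssup P G S (esssup P G S).
Proof. by move=> Sy; exact: (xgetI (P := [set y | is_esssup P G S y]) _ Sy). Qed.

(** The assumptions on one g_t, with G and G' standing for the sigma-algebras at t and t + 1; the
    body matches the hypothesis of the theorem, which can be passed as it is. *)
Definition utility_generator G G' (g : (Omega -> \bar R) -> Omega -> \bar R) :=
  [/\ maps_to_L0bar P (L0bar P G') (fun z z' => z = z' %[ae P]) G g,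
      concave_wrt P G G' g,
      increasing_on P (L0bar P G') (ae_le P) g,
      seq_usc_on P (L0bar P G') (ae_cvg P) g
    & g (cst 0%E) = cst 0%E %[ae P]].

End RandomVariableSpaces.

(** * The one-step utility u(x, y) = x g(y / x) *)

Section WealthUtility.
Context {d : measure_display} {Omega : measurableType d} {R : realType}.
Variable P : probability Omega R.
Context {G G' : set (set Omega)} {g : (Omega -> \bar R) -> Omega -> \bar R}.
Hypothesis GG' : G `<=` G'.
Hypothesis g_maps :
  maps_to_L0bar P (L0bar P G') (fun z z' => z = z' %[ae P]) G g.
Hypothesis g_concave : concave_wrt P G G' g.
Hypothesis g_incr : increasing_on P (L0bar P G') (ae_le P) g.
Hypothesis g_usc : seq_usc_on P (L0bar P G') (ae_cvg P) g.
Hypothesis g0 : g (cst 0%E) = cst 0%E %[ae P].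
Implicit Types (x : Omega -> R) (y : Omega -> \bar R).

Lemma L0bar_div x y : L0pp P G x -> L0bar P G' y ->
  L0bar P G' (fun w => ((x w)^-1)%:E * y w)%E.
Proof. by move=> xG; apply/L0barZ/(L0pp_sub GG')/L0ppV. Qed.

Lemma wealth_utility_L0bar x y : L0pp P G x -> L0bar P G' y ->
  L0bar P G (wealth_utility g x y).
Proof. by move=> xG yG; apply: L0barZ => //; apply/g_maps.1/L0bar_div. Qed.

Lemma wealth_utility_ae_eq x x' y y' :
  L0pp P G x -> L0pp P G x' -> L0bar P G' y -> L0bar P G' y' ->
  x = x' %[ae P] -> y = y' %[ae P] ->
  wealth_utility g x y = wealth_utility g x' y' %[ae P].
Proof.
move=> xG x'G yG y'G /ae_of_ae_eq xx' /ae_of_ae_eq yy'.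
have /ae_of_ae_eq gg : g (fun w => ((x w)^-1)%:E * y w)%E =
    g (fun w => ((x' w)^-1)%:E * y' w)%E %[ae P].
  apply: g_maps.2; [exact: L0bar_div|exact: L0bar_div|].
  by apply: ae_eqP; apply: filterS2 xx' yy' => w -> ->.
by apply: ae_eqP; apply: filterS2 xx' gg => w; rewrite /wealth_utility => -> ->.
Qed.

(** Where l > 0, (l y) / (l x) = y / x, so only the outer factor l survives. The cancellation is
    almost sure, hence the appeal to compatibility of [g] with almost sure equality. *)
Lemma wealth_utilityZ l x y :
  L0pp P G l -> L0pp P G x -> L0bar P G' y ->
  wealth_utility g (fun w => l w * x w) (fun w => (l w)%:E * y w)%E =
  (fun w => (l w)%:E * wealth_utility g x y w)%E %[ae P].
Proof.
move=> lG xG yG.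
have lG' : L0pp P G' l by exact: L0pp_sub lG.
have /ae_of_ae_eq gg :
    g (fun w => ((l w * x w)^-1)%:E * ((l w)%:E * y w))%E =
    g (fun w => ((x w)^-1)%:E * y w)%E %[ae P].
  apply: g_maps.2; [|exact: L0bar_div|].
    by apply: L0bar_div; [exact: L0ppM|exact: L0barZ].
  apply: ae_eqP; apply: filterS lG.2 => w lw; rewrite muleA -EFinM.
  by rewrite invfM mulrAC mulVf ?mul1r// gt_eqF.
by apply: ae_eqP; apply: filterS gg => w; rewrite /wealth_utility => ->; rewrite muleA.
Qed.

(* Concavity of [g] with weight x / (x + x'). *)
Lemma wealth_utility_superadditive x x' y y' :
  L0pp P G x -> L0pp P G x' -> L0bar P G' y -> L0bar P G' y' ->
  ae_le P (fun w => wealth_utility g x y w + wealth_utility g x' y' w)%E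
    (wealth_utility g (fun w => x w + x' w) (fun w => y w + y' w)%E).
Proof.
move=> xG x'G yG y'G.
have sG : L0pp P G (fun w => x w + x' w) by exact: L0ppD.
pose l w := x w / (x w + x' w).
have lG : L0pp P G l by apply: L0ppM => //; exact: L0ppV.
have l1 : ae_le P l (cst 1).
  apply: filterS2 xG.2 x'G.2 => w x0 x'0.
  by rewrite /l /= ler_pdivrMr ?mul1r ?lerDl ?addr_gt0// ltW.
have l0 : ae_le P (cst 0) l by apply: filterS lG.2 => w; exact: ltW.
pose z w := ((x w)^-1%:E * y w)%E; pose z' w := ((x' w)^-1%:E * y' w)%E.
have zG : L0bar P G' z by exact: L0bar_div.
have z'G : L0bar P G' z' by exact: L0bar_div.
(* Since l / x = (1 - l) / x' = 1 / (x + x'), the convex combination collapses to the argument of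
   [g] on the right-hand side. *)
have lE : \forall w \ae P,
    ((l w)%:E * z w + (1 - l w)%:E * z' w = (x w + x' w)^-1%:E * (y w + y' w))%E.
  have pos := ae_and xG.2 x'G.2; have lty := ae_and yG.2 y'G.2.
  apply: filterS2 pos lty => w [x0 x'0] [yoo y'oo].
  rewrite /z /z' !muleA -!EFinM muleDr_lty// /l.
  by congr (_%:E * _ + _%:E * _)%E; field; rewrite !gt_eqF ?addr_gt0.
have lzG : L0bar P G' (fun w => (x w + x' w)^-1%:E * (y w + y' w))%E.
  by apply: L0bar_div => //; exact: L0barD.
have lzG' : L0bar P G' (fun w => (l w)%:E * z w + (1 - l w)%:E * z' w)%E.
  split; last first.
    by apply: filterS2 lE lzG.2 => w -> .
  have ml : measurable_wrt G' l by exact: measurable_wrt_sub lG.1.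
  apply: emeasurable_funD; apply: emeasurable_funM; first exact/measurable_EFinP.
  - exact: zG.1.
  - by apply/measurable_EFinP; apply: measurable_funB => //; exact: measurable_cst.
  - exact: z'G.1.
have /ae_of_ae_eq gE := g_maps.2 _ _ lzG' lzG (ae_eqP lE).
have gc := g_concave zG z'G lG.1 l0 l1.
have gz := ae_and (g_maps.1 _ zG).2 (g_maps.1 _ z'G).2.
have pos := ae_and xG.2 x'G.2.
apply: filterS3 (ae_and gE gz) gc pos => w [-> [gz1 gz2]] gc [x0 x'0].
rewrite /wealth_utility -/z -/z'.
have s0 : 0 < x w + x' w by exact: addr_gt0.
(* Divided by x + x', the left-hand side is l g(z) + (1 - l) g(z'); distributing is legitimate
   because both terms are below +oo. *)
rewrite -(@lee_pdivrMl _ _ _ _)//.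
apply: le_trans gc.
rewrite muleDr_lty//; try by apply: lte_mul_pinfty; rewrite ?lee_fin// ltW.
rewrite !muleA -!EFinM /l.
rewrite le_eqVlt; apply/orP; left; apply/eqP.
by congr (_%:E * _ + _%:E * _)%E; field; rewrite !gt_eqF.
Qed.

Lemma wealth_utility_incr_r x y y' :
  L0pp P G x -> L0bar P G' y -> L0bar P G' y' -> ae_le P y y' ->
  ae_le P (wealth_utility g x y) (wealth_utility g x y').
Proof.
move=> xG yG y'G yy'.
have gg : ae_le P (g (fun w => (x w)^-1%:E * y w)%E)
                  (g (fun w => (x w)^-1%:E * y' w)%E).
  apply: g_incr; [exact: L0bar_div|exact: L0bar_div|].
  by apply: filterS2 xG.2 yy' => w x0; rewrite lee_pmul2l// lte_fin invr_gt0.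
by apply: filterS2 xG.2 gg => w x0; rewrite /wealth_utility lee_pmul2l// lte_fin.
Qed.

(* Concavity of [g] between y / x and 0 with weight x / x', using g(0) = 0. *)
Lemma wealth_utility_incr_l x x' y :
  L0pp P G x -> L0pp P G x' -> L0bar P G' y -> ae_le P x x' ->
  ae_le P (wealth_utility g x y) (wealth_utility g x' y).
Proof.
move=> xG x'G yG xx'.
pose l w := x w / x' w.
have lG : L0pp P G l by apply: L0ppM => //; exact: L0ppV.
have l0 : ae_le P (cst 0) l by apply: filterS lG.2 => w; exact: ltW.
have l1 : ae_le P l (cst 1).
  by apply: filterS2 x'G.2 xx' => w x'0 xx'; rewrite /l/= ler_pdivrMr ?mul1r.
pose z w := ((x w)^-1%:E * y w)%E.
have zG : L0bar P G' z by exact: L0bar_div.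
have zero : L0bar P G' (cst 0%E).
  by split; [exact: measurable_cst|apply: aeW => w; rewrite ltry].
have gc := g_concave zG zero lG.1 l0 l1.
have gE : g (fun w => (l w)%:E * z w + (1 - l w)%:E * cst 0 w)%E =
    g (fun w => (x' w)^-1%:E * y w)%E %[ae P].
  have lE : \forall w \ae P,
      ((l w)%:E * z w + (1 - l w)%:E * 0 = (x' w)^-1%:E * y w)%E.
    apply: filterS xG.2 => w x0; rewrite mule0 adde0 muleA -EFinM /l.
    by rewrite mulrAC divff ?mul1r// gt_eqF.
  apply: g_maps.2 (ae_eqP lE); last exact: L0bar_div.
  rewrite (_ : (fun w => _) = fun w => (l w)%:E * z w)%E.
    by apply: L0barZ => //; exact: L0pp_sub lG.
  by apply/funext => w; rewrite /= mule0 adde0.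
apply: filterS3 (ae_and x'G.2 (ae_of_ae_eq g0)) (ae_of_ae_eq gE) gc.
move=> w [x'0 ->] ->; rewrite /= mule0 adde0 /wealth_utility -/z => gc.
by rewrite -lee_pdivrMl// muleA -EFinM mulrC.
Qed.

(* Concavity with the indicator of [E] as weight only sees [y] on [E], because
   0 * -oo = 0. *)
Lemma concave_local (E : set Omega) y y' : G E -> L0bar P G' y ->
  L0bar P G' y' -> (\forall w \ae P, E w -> y w = y' w) ->
  \forall w \ae P, E w -> g y w = g y' w.
Proof.
move=> GE.
(* The assumption is symmetric in the two arguments, so one inequality suffices. *)
suff le z z' : L0bar P G' z -> L0bar P G' z' ->
    (\forall w \ae P, E w -> z w = z' w) ->
    \forall w \ae P, E w -> (g z w <= g z' w)%E.
  move=> yG y'G yy'; have y'y : \forall w \ae P, E w -> y' w = y w.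
    by apply: filterS yy' => w + Ew => ->.
  apply: filterS2 (le _ _ yG y'G yy') (le _ _ y'G yG y'y) => w gg g'g Ew.
  by apply/le_anti; rewrite gg// g'g.
move=> zG z'G zz'.
have lG : L0 G (\1_E : Omega -> R).
  by apply: measurable_indic; exact: sub_sigma_algebra.
have l0 : ae_le P (cst 0) (\1_E : Omega -> R) by apply: aeW => w /=.
have l1 : ae_le P (\1_E : Omega -> R) (cst 1).
  by apply: aeW => w /=; rewrite indicE; case: (_ \in _).
have gc := g_concave zG z'G lG l0 l1.
(* The combination is almost surely z': on E because z = z' there, off E because the weight of z
   vanishes. Concavity then bounds g(z') from below, and on E this bound is g(z). *)
have lE : \forall w \ae P,
    ((\1_E w : R)%:E * z w + (1 - \1_E w)%:E * z' w = z' w)%E.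
  apply: filterS zz' => w zz'; rewrite indicE.
  case: (boolP (w \in E)) => [/set_mem Ew|_].
    by rewrite subrr mul0e adde0 mul1e zz'.
  by rewrite subr0 mul0e add0e mul1e.
have lzG : L0bar P G' (fun w => (\1_E w : R)%:E * z w + (1 - \1_E w)%:E * z' w)%E.
  split; last by apply: filterS2 lE z'G.2 => w ->.
  have ml : measurable_wrt G' (\1_E : Omega -> R) by exact: measurable_wrt_sub lG.
  apply: emeasurable_funD; apply: emeasurable_funM; first exact/measurable_EFinP.
  - exact: zG.1.
  - by apply/measurable_EFinP; apply: measurable_funB => //; exact: measurable_cst.
  - exact: z'G.1.
have gE := g_maps.2 _ _ lzG z'G (ae_eqP lE).
apply: filterS2 (ae_of_ae_eq gE) gc => w -> /[swap] Ew.
by rewrite indicE mem_set// subrr mul0e adde0 mul1e.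
Qed.

(** The quotients y / x and y / x' agree on E, so locality of [g] applies; stability of the value
    rests on this. *)
Lemma wealth_utility_local (E : set Omega) x x' y : G E -> L0pp P G x ->
  L0pp P G x' -> L0bar P G' y -> (forall w, E w -> x w = x' w) ->
  \forall w \ae P, E w -> wealth_utility g x y w = wealth_utility g x' y w.
Proof.
move=> GE xG x'G yG xx'; rewrite /wealth_utility.
have := @concave_local E (fun w => (x w)^-1%:E * y w)%E
  (fun w => (x' w)^-1%:E * y w)%E GE (L0bar_div xG yG) (L0bar_div x'G yG).
have EE : \forall w \ae P, E w -> ((x w)^-1%:E * y w = (x' w)^-1%:E * y w)%E.
  by apply: aeW => w /xx' ->.
by move=> /(_ EE); apply: filterS => w gg Ew; rewrite gg// xx'.
Qed.

(** The arguments y / x_k converge to y / l, so semi-continuity of [g] bounds the inner limit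
    superior; the outer factors x_k converge to a positive limit and are absorbed by
    [limn_esupM]. *)
Lemma wealth_utility_usc (x : nat -> Omega -> R) (l : Omega -> R) y :
  (forall k, L0pp P G (x k)) -> L0pp P G l -> L0bar P G' y ->
  ae_cvg P x l ->
  ae_le P (fun w => limn_esup (fun k => wealth_utility g (x k) y w))
    (wealth_utility g l y).
Proof.
move=> xG lG yG xl.
pose z k w := ((x k w)^-1%:E * y w)%E.
pose z' w := ((l w)^-1%:E * y w)%E.
have zG k : L0bar P G' (z k) by exact: L0bar_div.
have z'G : L0bar P G' z' by exact: L0bar_div.
have zz' : ae_cvg P z z'.
  apply: filterS2 xl lG.2 => w xl l0.
  have ixl : (fun k => (x k w)^-1%:E) @ \oo --> (l w)^-1%:E.
    by apply: cvg_EFin; [exact: nearW|apply: cvgV => //; rewrite gt_eqF].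
  (* The limit 1 / l is nonzero, so the product of limits is well defined even where y is
     infinite. *)
  apply: cvgeM ixl (cvg_cst _).
  by case: (y w) => //=; rewrite invr_neq0// gt_eqF.
have gz := g_usc zG z'G zz'.
apply: filterS3 gz xl lG.2 => w gz xl l0.
exact: limn_esupM.
Qed.

End WealthUtility.

(** * Homogeneity, superadditivity and regularity of the composed utilities *)

Section ComposedUtility.
Context {d : measure_display} {Omega : measurableType d} {R : realType}.
Variable P : probability Omega R.
Variables (T : nat) (F : nat -> set (set Omega)).
Variable g : nat -> (Omega -> \bar R) -> Omega -> \bar R.
Hypothesis FT : filtration T F.
Hypothesis g_utility : forall t, (t < T)%N ->
  utility_generator P (F t) (F t.+1) (g t).
Implicit Types (h l : Omega -> R) (x : nat -> Omega -> R).

Local Notation U := (composed_utility g).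

(** Feasibility without the budget constraint, so that it applies to the plan of one agent and to
    the aggregate alike; times s > t are those read by a composition started at t. *)
Definition positive_after (t : nat) x :=
  forall s, (t < s)%N -> (s <= T)%N -> L0pp P (F s) (x s).

Lemma positive_afterS t x : positive_after t x -> positive_after t.+1 x.
Proof. by move=> xF s ts; exact/xF/ltnW. Qed.

Lemma filtration_sub s t : (s <= t)%N -> (t <= T)%N -> F s `<=` F t.
Proof. by have [_ + _] := FT; apply. Qed.

Lemma filtration_measurable t : (t <= T)%N -> F t `<=` measurable.
Proof. by have [_ sub <-] := FT => tT; exact: sub. Qed.

Lemma composed_utility_L0bar n t h x : (t + n <= T)%N ->
  L0pp P (F t) h -> positive_after t x -> L0bar P (F t) (U n t h x).
Proof.
elim: n t h => [|n IH] t h tT hF xF /=; first exact: L0bar_fin.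
have t1T : (t < T)%N by lia.
have [gm _ _ _ _] := g_utility t1T.
apply: (wealth_utility_L0bar (filtration_sub (leqnSn t) t1T) gm hF).
apply: IH; [lia|exact: xF|exact: positive_afterS].
Qed.

Lemma composed_utility_ae_eq n t h h' x x' : (t + n <= T)%N ->
  L0pp P (F t) h -> L0pp P (F t) h' ->
  positive_after t x -> positive_after t x' ->
  h = h' %[ae P] ->
  (forall s, (t < s)%N -> (s <= T)%N -> x s = x' s %[ae P]) ->
  U n t h x = U n t h' x' %[ae P].
Proof.
elim: n t h h' => [|n IH] t h h' tT hF h'F xF x'F hh' xx' /=.
  by apply: ae_eqP; apply: filterS (ae_of_ae_eq hh') => w ->.
have t1T : (t < T)%N by lia.
have tnT : (t.+1 + n <= T)%N by lia.
have [gm _ _ _ _] := g_utility t1T.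
have xF1 := xF _ (ltnSn t) t1T; have x'F1 := x'F _ (ltnSn t) t1T.
have xFS := positive_afterS xF; have x'FS := positive_afterS x'F.
apply: (wealth_utility_ae_eq (filtration_sub (leqnSn t) t1T) gm hF h'F) => //.
- exact: composed_utility_L0bar.
- exact: composed_utility_L0bar.
- by apply: IH => //; [exact: xx'|move=> s ts; exact/xx'/ltnW].
Qed.

Lemma positive_afterZ t l x : (t <= T)%N -> L0pp P (F t) l ->
  positive_after t x -> positive_after t (fun s w => l w * x s w).
Proof.
move=> tT lF xF s ts sT; apply: L0ppM; last exact: xF.
exact: L0pp_sub (filtration_sub (ltnW ts) sT) lF.
Qed.

(** A factor known at time t is known at all later times, so it can be pulled out of each layer,
    from the terminal identity outwards. *)
Lemma composed_utilityZ n t l h x : (t + n <= T)%N ->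
  L0pp P (F t) l -> L0pp P (F t) h -> positive_after t x ->
  U n t (fun w => l w * h w) (fun s w => l w * x s w) =
  (fun w => (l w)%:E * U n t h x w)%E %[ae P].
Proof.
elim: n t h => [|n IH] t h tT lF hF xF /=.
  by apply: ae_eqP; apply: aeW => w; rewrite EFinM.
have t1T : (t < T)%N by lia.
have tnT : (t.+1 + n <= T)%N by lia.
have [gm _ _ _ _] := g_utility t1T.
have sub := filtration_sub (leqnSn t) t1T.
have xF1 := xF _ (ltnSn t) t1T; have xFS := positive_afterS xF.
have lF1 : L0pp P (F t.+1) l := L0pp_sub sub lF.
have uF : L0bar P (F t.+1) (U n t.+1 (x t.+1) x).
  exact: composed_utility_L0bar.
apply: ae_eq_trans (wealth_utilityZ sub gm lF hF uF).
apply: (wealth_utility_ae_eq sub gm); [exact: L0ppM|exact: L0ppM| | | |exact: IH].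
- by apply: composed_utility_L0bar; [|exact: L0ppM|exact: positive_afterZ].
- exact: L0barZ.
- exact: ae_eq_refl.
Qed.

(** One-step superadditivity treats the outer layer; monotonicity in the second argument then lets
    the induction hypothesis act on the inner one. *)
Lemma composed_utility_superadditive n t h h' x x' : (t + n <= T)%N ->
  L0pp P (F t) h -> L0pp P (F t) h' ->
  positive_after t x -> positive_after t x' ->
  ae_le P (fun w => U n t h x w + U n t h' x' w)%E
    (U n t (fun w => h w + h' w) (fun s w => x s w + x' s w)).
Proof.
elim: n t h h' => [|n IH] t h h' tT hF h'F xF x'F /=.
  by apply: aeW => w; rewrite EFinD.
have t1T : (t < T)%N by lia.
have tnT : (t.+1 + n <= T)%N by lia.
have [gm gc gi _ _] := g_utility t1T.
have sub := filtration_sub (leqnSn t) t1T.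
have xF1 := xF _ (ltnSn t) t1T; have x'F1 := x'F _ (ltnSn t) t1T.
have xFS := positive_afterS xF; have x'FS := positive_afterS x'F.
have uF := composed_utility_L0bar tnT xF1 xFS.
have u'F := composed_utility_L0bar tnT x'F1 x'FS.
apply: ae_le_trans (wealth_utility_superadditive sub gm gc hF h'F uF u'F) _.
apply: (wealth_utility_incr_r sub gi).
- exact: L0ppD.
- exact: L0barD.
- apply: composed_utility_L0bar => //; first exact: L0ppD.
  by move=> s ts sT; apply: L0ppD; [exact: xFS|exact: x'FS].
- exact: IH.
Qed.

Lemma composed_utility_sum (I : Type) (r : seq I) n t (h : I -> Omega -> R)
    (x : I -> nat -> Omega -> R) : (0 < size r)%N -> (t + n <= T)%N ->
  L0ppv P (F t) h -> (forall i, positive_after t (x i)) ->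
  ae_le P (fun w => \sum_(i <- r) U n t (h i) (x i) w)%E
    (U n t (fun w => \sum_(i <- r) h i w) (fun s w => \sum_(i <- r) x i s w)).
Proof.
move=> + tT hF xF; elim: r => // i [|j r] IH _.
  rewrite (_ : (fun w => _) = U n t (h i) (x i)); last first.
    by apply/funext => w; rewrite big_seq1.
  rewrite (_ : (fun w => \sum_(_ <- _) _) = h i); last first.
    by apply/funext => w; rewrite big_seq1.
  rewrite (_ : (fun s w => \sum_(_ <- _) _) = x i); last first.
    by apply/funext => s; apply/funext => w; rewrite big_seq1.
  exact/ae_eq_le/ae_eq_refl.
rewrite (_ : (fun w => \sum_(_ <- _) h _ _) =
    fun w => h i w + \sum_(k <- j :: r) h k w); last first.
  by apply/funext => w; rewrite big_cons.
rewrite (_ : (fun s w => \sum_(_ <- _) _) =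
    fun s w => x i s w + \sum_(k <- j :: r) x k s w); last first.
  by apply/funext => s; apply/funext => w; rewrite big_cons.
apply: ae_le_trans (composed_utility_superadditive tT (hF i) _ (xF i) _).
- by apply: filterS (IH isT) => w IHw; rewrite big_cons leeD2l.
- exact: L0pp_sum.
- by move=> s ts sT; apply: L0pp_sum => // k; exact: xF.
Qed.

(** Here and in the next two lemmas h enters only the outermost layer while the inner value is
    fixed, so a case distinction on n replaces induction. *)
Lemma composed_utility_incr n t h h' x : (t + n <= T)%N ->
  L0pp P (F t) h -> L0pp P (F t) h' -> positive_after t x ->
  ae_le P h h' -> ae_le P (U n t h x) (U n t h' x).
Proof.
case: n => [|n] tT hF h'F xF hh' /=.
  by apply: filterS hh' => w; rewrite lee_fin.
have t1T : (t < T)%N by lia.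
have [gm gc _ _ g0] := g_utility t1T.
apply: (wealth_utility_incr_l (filtration_sub (leqnSn t) t1T) gm gc g0) => //.
by apply: composed_utility_L0bar; [lia|exact: xF|exact: positive_afterS].
Qed.

Lemma composed_utility_local n t (E : set Omega) h h' x : (t + n <= T)%N ->
  F t E -> L0pp P (F t) h -> L0pp P (F t) h' -> positive_after t x ->
  (forall w, E w -> h w = h' w) ->
  \forall w \ae P, E w -> U n t h x w = U n t h' x w.
Proof.
case: n => [|n] tT FE hF h'F xF hh' /=; first by apply: aeW => w /hh' ->.
have t1T : (t < T)%N by lia.
have [gm gc _ _ _] := g_utility t1T.
apply: (wealth_utility_local (filtration_sub (leqnSn t) t1T) gm gc FE) => //.
by apply: composed_utility_L0bar; [lia|exact: xF|exact: positive_afterS].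
Qed.

Lemma composed_utility_usc n t (h : nat -> Omega -> R) l x : (t + n <= T)%N ->
  (forall k, L0pp P (F t) (h k)) -> L0pp P (F t) l -> positive_after t x ->
  ae_cvg P h l ->
  ae_le P (fun w => limn_esup (fun k => U n t (h k) x w)) (U n t l x).
Proof.
case: n => [|n] tT hF lF xF hl /=.
  apply: filterS hl => w hl; rewrite (cvg_limn_einf_sup (_ : _ --> (l w)%:E))//.
  by apply: cvg_EFin; first exact: nearW.
have t1T : (t < T)%N by lia.
have [gm _ _ gu _] := g_utility t1T.
apply: (wealth_utility_usc (filtration_sub (leqnSn t) t1T) gu) => //.
by apply: composed_utility_L0bar; [lia|exact: xF|exact: positive_afterS].
Qed.

End ComposedUtility.

(** * The proportional allocation and the value of the risk sharing problem *)

Section Value.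
Context {d : measure_display} {Omega : measurableType d} {R : realType}.
Variable P : probability Omega R.
Context {A : finType} {T : nat} {F : nat -> set (set Omega)}.
Context {g : nat -> (Omega -> \bar R) -> Omega -> \bar R}.
Context {H : A -> nat -> Omega -> R}.
Local Notation Hagg := (fun t w => \sum_(a : A) H a t w).
Hypothesis FT : filtration T F.
Hypothesis HF : forall a t, (t <= T)%N -> L0pp P (F t) (H a t).
Hypothesis g_utility : forall t, (t < T)%N ->
  utility_generator P (F t) (F t.+1) (g t).
Variable t : nat.
Hypothesis tT : (t <= T)%N.
Implicit Types (h : A -> Omega -> R) (x : A -> nat -> Omega -> R).

Let tTt : (t + (T - t) <= T)%N. Proof. by rewrite subnKC. Qed.

(** The candidate optimiser for arbitrary time-t endowments h, the later aggregates being kept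
    fixed; [h a = H a t] gives the allocation of the theorem. *)
Definition proportional h : A -> nat -> Omega -> R :=
  fun a s w => h a w / (\sum_b h b w) * (\sum_b H b s w).

(* Without agents there is no aggregate wealth in ]0, +oo[, and every objective is
   the empty sum. *)
Definition aggregate_utility h : Omega -> \bar R :=
  if #|A| == 0%N then cst 0%E
  else composed_utility g (T - t) t (fun w => \sum_a h a w) Hagg.

Lemma sum_L0pp s h : (0 < #|A|)%N -> L0ppv P (F s) h ->
  L0pp P (F s) (fun w => \sum_a h a w).
Proof.
by move=> A0; apply: L0pp_sum; rewrite [index_enum _]unlock -enumT -cardE.
Qed.

Lemma Hagg_positive_after : (0 < #|A|)%N -> positive_after P T F t Hagg.
Proof. by move=> A0 s ts sT; apply: sum_L0pp => // a; exact: HF. Qed.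

Lemma share_L0pp h a : L0ppv P (F t) h ->
  L0pp P (F t) (fun w => h a w / \sum_b h b w).
Proof.
move=> hF; apply: L0ppM; first exact: hF.
by apply/L0ppV/sum_L0pp => //; apply/card_gt0P; exists a.
Qed.

Lemma sum_share h : (0 < #|A|)%N -> L0ppv P (F t) h ->
  \forall w \ae P, \sum_a (h a w / \sum_b h b w) = 1.
Proof.
move=> A0 hF; apply: filterS (sum_L0pp A0 hF).2 => w h0.
by rewrite -mulr_suml divff// gt_eqF.
Qed.

Lemma proportional_feasible h : L0ppv P (F t) h ->
  feasible P T F Hagg t (proportional h).
Proof.
move=> hF s ts sT; have sub := filtration_sub FT (ltnW ts) sT.
split=> [a|].
  have A0 : (0 < #|A|)%N by apply/card_gt0P; exists a.
  apply: L0ppM; first exact/(L0pp_sub sub)/share_L0pp.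
  exact: Hagg_positive_after.
(* Without agents both sides of the budget constraint are empty sums. *)
have [A0|] := posnP #|A|.
  by apply: ae_eqP; apply: aeW => w; rewrite !big_pred0//; exact: card0_eq.
move=> A0; apply: ae_eqP; apply: filterS (sum_share A0 hF) => w hw.
by rewrite -mulr_suml hw mul1r.
Qed.

Lemma objective_proportional h : L0ppv P (F t) h ->
  objective T g t h (proportional h) = aggregate_utility h %[ae P].
Proof.
move=> hF; rewrite /aggregate_utility; have [A0|] := posnP #|A|.
  apply: ae_eqP; apply: aeW => w.
  by rewrite /objective big_pred0//; exact: card0_eq.
move=> A0.
have hs := sum_L0pp A0 hF.
have HP := Hagg_positive_after A0.
have UF := composed_utility_L0bar FT g_utility tTt hs HP.
have hom : \forall w \ae P, forall a,
    composed_utility g (T - t) t (h a) (proportional h a) w =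
    ((h a w / \sum_b h b w)%R%:E *
      composed_utility g (T - t) t (fun w => \sum_b h b w)%R Hagg w)%E.
  apply: filter_forall => a; apply: ae_of_ae_eq.
  have lF := share_L0pp a hF.
  apply: ae_eq_trans (composed_utilityZ FT g_utility tTt lF hs HP).
  apply: (composed_utility_ae_eq FT g_utility tTt).
  - exact: hF.
  - exact: L0ppM.
  - by move=> s ts sT; exact: (proportional_feasible hF ts sT).1.
  - exact: positive_afterZ.
  (* At time t itself, share times total endowment gives back h a, the total being positive. *)
  - apply: ae_eqP; apply: filterS hs.2 => w s0.
    by rewrite divfK// gt_eqF.
  - by move=> s _ _; exact: ae_eq_refl.
apply: ae_eqP.
have l0 : \forall w \ae P, forall a, 0 < h a w / \sum_b h b w.
  by apply: filter_forall => a; exact: (share_L0pp a hF).2.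
apply: filterS3 hom (sum_share A0 hF) l0 => w hw sw l0.
(* The common factor may be -oo; it can be taken out of the sum because the shares are
   nonnegative. *)
rewrite /objective (eq_bigr _ (fun a _ => hw a)) -ge0_sume_distrl.
  by rewrite sumEFin sw mul1e.
by move=> a _; rewrite lee_fin ltW.
Qed.

Lemma objective_le_aggregate h x : L0ppv P (F t) h ->
  feasible P T F Hagg t x ->
  ae_le P (objective T g t h x) (aggregate_utility h).
Proof.
move=> hF xF; rewrite /aggregate_utility; have [A0|] := posnP #|A|.
  apply: aeW => w.
  by rewrite /objective big_pred0//; exact: card0_eq.
move=> A0.
have hs := sum_L0pp A0 hF.
have xP a : positive_after P T F t (x a).
  by move=> s ts sT; exact: (xF s ts sT).1.
have := composed_utility_sum FT g_utility (r := index_enum A) _ tTt hF xP.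
rewrite {1}[index_enum _]unlock -enumT -cardE => /(_ A0) le_sum.
(* The bound involves the summed plan of the agents, which the budget constraint identifies with the
   aggregate only almost surely. *)
apply: ae_le_trans le_sum (ae_eq_le _).
apply: (composed_utility_ae_eq FT g_utility tTt hs hs).
- by move=> s ts sT; apply: sum_L0pp => // a; exact: xP.
- exact: Hagg_positive_after.
- exact: ae_eq_refl.
- by move=> s ts sT; exact: (xF s ts sT).2.
Qed.

Lemma aggregate_utility_L0bar h : L0ppv P (F t) h ->
  L0bar P (F t) (aggregate_utility h).
Proof.
move=> hF; rewrite /aggregate_utility; case: eqP => [_|/eqP].
  by split; [exact: measurable_cst|apply: aeW => w; rewrite ltry].
rewrite -lt0n => A0.
apply: (composed_utility_L0bar FT g_utility tTt); first exact: sum_L0pp.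
exact: Hagg_positive_after.
Qed.

Lemma objective_L0bar h x : L0ppv P (F t) h -> feasible P T F Hagg t x ->
  L0bar P (F t) (objective T g t h x).
Proof.
move=> hF xF.
have uF a : L0bar P (F t) (composed_utility g (T - t) t (h a) (x a)).
  apply: (composed_utility_L0bar FT g_utility tTt) => //.
  by move=> s ts sT; exact: (xF s ts sT).1.
split; first by apply: emeasurable_sum => a; exact: (uF a).1.
have : \forall w \ae P, forall a,
    (composed_utility g (T - t) t (h a) (x a) w < +oo)%E.
  by apply: filter_forall => a; exact: (uF a).2.
by apply: filterS => w uw; apply: lte_sum_pinfty.
Qed.

Lemma objective_le_proportional h x : L0ppv P (F t) h ->
  feasible P T F Hagg t x ->
  ae_le P (objective T g t h x) (objective T g t h (proportional h)).
Proof.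
move=> hF xF; apply: ae_le_trans (objective_le_aggregate hF xF) _.
exact/ae_eq_le/ae_eq_sym/objective_proportional.
Qed.

Lemma proportional_esssup h : L0ppv P (F t) h ->
  is_esssup P (F t) (attainable P T F g Hagg t h)
    (objective T g t h (proportional h)).
Proof.
move=> hF; apply: is_esssup_max.
- by exists (proportional h) => //; exact: proportional_feasible.
- exact: (objective_L0bar hF (proportional_feasible hF)).1.
- by move=> _ [x xF <-]; exact: objective_le_proportional.
Qed.

Lemma value_esssup h : L0ppv P (F t) h ->
  is_esssup P (F t) (attainable P T F g Hagg t h) (value P T F g Hagg t h).
Proof. by move=> hF; exact: esssupP (proportional_esssup hF). Qed.

Lemma value_proportional h : L0ppv P (F t) h ->
  value P T F g Hagg t h = objective T g t h (proportional h) %[ae P].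
Proof.
move=> hF; apply: is_esssup_ae_eq (filtration_measurable FT tT) _ _.
  exact: value_esssup.
exact: proportional_esssup.
Qed.

(** The properties of the value below are proved for this closed form and carried over through the
    almost sure equality. *)
Lemma value_aggregate h : L0ppv P (F t) h ->
  value P T F g Hagg t h = aggregate_utility h %[ae P].
Proof.
move=> hF.
exact: ae_eq_trans (value_proportional hF) (objective_proportional hF).
Qed.

Lemma proportional_optimal h : L0ppv P (F t) h ->
  optimal P T F g Hagg t h (proportional h).
Proof.
move=> hF; split; first exact: proportional_feasible.
  by move=> x; exact: objective_le_proportional.
exact: value_proportional.
Qed.

Lemma aggregate_utility_incr h h' : L0ppv P (F t) h -> L0ppv P (F t) h' ->
  ae_lev P h h' -> ae_le P (aggregate_utility h) (aggregate_utility h').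
Proof.
move=> hF h'F hh'; rewrite /aggregate_utility; case: eqP => [_|/eqP].
  exact/ae_eq_le/ae_eq_refl.
rewrite -lt0n => A0.
apply: (composed_utility_incr FT g_utility tTt).
- exact: sum_L0pp.
- exact: sum_L0pp.
- exact: Hagg_positive_after.
have : \forall w \ae P, forall a, h a w <= h' a w by exact: filter_forall.
by apply: filterS => w hw; apply: ler_sum.
Qed.

Lemma value_L0bar : maps_to_L0bar P (L0ppv P (F t)) (ae_eqv P) (F t)
  (value (A := A) P T F g Hagg t).
Proof.
split=> [h hF|h h' hF h'F hh'].
  have vE := ae_of_ae_eq (value_aggregate hF).
  split; first by have [] := value_esssup hF.
  by apply: filterS2 vE (aggregate_utility_L0bar hF).2 => w ->.
apply: ae_eq_trans (value_aggregate hF) _.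
apply: ae_eq_trans (ae_eq_sym (value_aggregate h'F)).
apply: ae_le_anti; apply: aggregate_utility_incr => // a.
  by apply: filterS (ae_of_ae_eq (hh' a)) => w ->.
by apply: filterS (ae_of_ae_eq (hh' a)) => w ->.
Qed.

Lemma value_incr : increasing_on P (L0ppv P (F t)) (ae_lev P)
  (value (A := A) P T F g Hagg t).
Proof.
move=> h h' hF h'F hh'.
apply: ae_le_trans (ae_eq_le (value_aggregate hF)) _.
apply: ae_le_trans (ae_eq_le (ae_eq_sym (value_aggregate h'F))).
exact: aggregate_utility_incr.
Qed.

(** On [E k] the total of the pasted endowments is the total of [h k], so locality of the composed
    utility applies there; the exceptional sets of the countably many cells are merged. *)
Lemma value_stable : stable_on P (F t) (L0ppv P (F t))
  (value (A := A) P T F g Hagg t).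
Proof.
move=> E h pE hF.
pose h' a := paste E (fun k => h k a).
have h'F : L0ppv P (F t) h'.
  by move=> a; apply: paste_L0pp => // k; exact: hF.
apply: ae_eq_trans (value_aggregate h'F) _.
have loc k : \forall w \ae P,
    E k w -> aggregate_utility h' w = aggregate_utility (h k) w.
  rewrite /aggregate_utility; case: eqP => [_|/eqP]; first exact: aeW.
  rewrite -lt0n => A0; have [FE _ _] := pE.
  apply: (composed_utility_local FT g_utility tTt (FE k)).
  - exact: sum_L0pp.
  - exact: sum_L0pp.
  - exact: Hagg_positive_after.
  by move=> w Ekw; apply: eq_bigr => a _; rewrite /h' (pasteE _ pE Ekw).
have val : \forall w \ae P, forall k,
    value P T F g Hagg t (h k) w = aggregate_utility (h k) w.
  by apply: ae_foralln => k; exact/ae_of_ae_eq/value_aggregate.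
apply: ae_eqP; apply: filterS2 (ae_foralln loc) val => w locw valw.
have [k Ekw] := countable_partition_cover w pE.
by rewrite (pasteE _ pE Ekw) valw; exact: locw.
Qed.

Lemma value_usc : seq_usc_on P (L0ppv P (F t)) (ae_cvgv P)
  (value (A := A) P T F g Hagg t).
Proof.
move=> h l hF lF hl.
(* A single null set serves all k, so the whole sequence can be replaced inside the limit
   superior. *)
have val : \forall w \ae P, forall k,
    value P T F g Hagg t (h k) w = aggregate_utility (h k) w.
  by apply: ae_foralln => k; exact/ae_of_ae_eq/value_aggregate.
apply: ae_le_trans (ae_eq_le (ae_eq_sym (value_aggregate lF))).
suff usc : ae_le P (fun w => limn_esup (fun k => aggregate_utility (h k) w))
    (aggregate_utility l).
  by apply: filterS2 val usc => w /funext ->.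
rewrite /aggregate_utility; case: eqP => [_|/eqP].
  by apply: aeW => w; apply: limn_esup_le_near; exact: nearW.
rewrite -lt0n => A0.
apply: (composed_utility_usc FT g_utility tTt).
- by move=> k; exact: sum_L0pp.
- exact: sum_L0pp.
- exact: Hagg_positive_after.
have : \forall w \ae P, forall a, (fun k => h k a w) @ \oo --> l a w.
  by apply: filter_forall => a; exact: hl.
by apply: filterS => w hlw; apply: (cvg_big add_continuous) => a _; exact: hlw.
Qed.

End Value.

(** The middle clause certifies that y_t(h), chosen by [esssup] with a default, is a genuine
    essential supremum for every positive endowment vector h. *)
Theorem proposition4p3 (d : measure_display) (Omega : measurableType d)
  (R : realType) (P : probability Omega R)
  (T : nat) (F : nat -> set (set Omega)) (A : finType)
  (H : A -> nat -> Omega -> R)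
  (g : nat -> (Omega -> \bar R) -> Omega -> \bar R)
  (Hagg := fun t w => \sum_(a : A) H a t w)
  (y := value (A := A) P T F g Hagg) :
  filtration T F ->
  (forall a t, (t <= T)%N -> L0pp P (F t) (H a t)) ->
  (forall t, (t < T)%N ->
    [/\ maps_to_L0bar P (L0bar P (F t.+1)) (fun z z' => z = z' %[ae P])
          (F t) (g t),
        concave_wrt P (F t) (F t.+1) (g t),
        increasing_on P (L0bar P (F t.+1)) (ae_le P) (g t),
        seq_usc_on P (L0bar P (F t.+1)) (ae_cvg P) (g t)
      & g t (cst 0%E) = cst 0%E %[ae P]]) ->
  forall t, (t <= T)%N ->
  [/\ optimal P T F g Hagg t (fun a => H a t)
        (fun a s w => H a t w / Hagg t w * Hagg s w),
      (forall h : A -> Omega -> R, L0ppv P (F t) h ->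
        is_esssup P (F t) (attainable P T F g Hagg t h) (y t h))
    & [/\ maps_to_L0bar P (L0ppv P (F t)) (ae_eqv P) (F t) (y t),
          stable_on P (F t) (L0ppv P (F t)) (y t),
          increasing_on P (L0ppv P (F t)) (ae_lev P) (y t)
        & seq_usc_on P (L0ppv P (F t)) (ae_cvgv P) (y t)]].
Proof.
move=> FT HF g_utility t tT.
split; [|exact: value_esssup|split].
- by apply: proportional_optimal => // a; exact: HF.
- exact: value_L0bar.
- exact: value_stable.
- exact: value_incr.
- exact: value_usc.
Qed.
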